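(* Let $n, a \in \mathbb{N}$ and let $p$ be a rational prime such that $p > n \geq 2$. Suppose $(x_1,\dots,x_n), (y_1,\dots,y_n) \in \mathbb{Z}^n$ satisfy $$x_1^j + \cdots + x_n^j \equiv y_1^j + \cdots + y_n^j \pmod{p^{na}} \qquad \text{for all } 1 \leq j \leq n.$$ Then there exists a permutation $\sigma$ of $\{1,\dots,n\}$ such that $x_j \equiv y_{\sigma(j)} \pmod{p^a}$ for all $1 \leq j \leq n$.
   Context: No non-standard notation is used. *)

(* Defs.v *)
From mathcomp Require Import all_boot all_order all_fingroup all_algebra.

Set Implicit Arguments.
Unset Strict Implicit.
Unset Printing Implicit Defensive.

(* Main.v *)
Require Import Defs.
From mathcomp Require Import all_boot all_order all_fingroup all_algebra.
From mathcomp Require Import ring zify.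

Set Implicit Arguments.
Unset Strict Implicit.
Unset Printing Implicit Defensive.

Import GRing.Theory.
Local Open Scope ring_scope.

(** Newton's identities express the elementary symmetric functions of n
    integers through their first n power sums, with divisions by 1, ..., n
    only.  As p > n, these divisions are possible modulo p^(na), so the two
    polynomials prod (X - x_i) and prod (X - y_i) are congruent modulo p^(na)
    ([power_sums_congr_prod_XsubC]).

    It remains to see that such a congruence forces each residue class modulo
    p^a to contain as many x_i as y_i, after which the multisets of residues
    agree and a permutation exists. Let P = prod (X - x_i). For a class c,
    substitute c + p^a X for the variable. A factor p^a X - z, where z = x_i -
    c, is p^a times a monic linear polynomial when p^a divides z; otherwise it
    is p^w, w < a, times a polynomial whose reduction modulo p is a nonzero
    constant. By Gauss's lemma, P(c + p^a X) = p^v Q where Q modulo p has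
    degree d equal to the number of x_i in the class of c, and v <= a d + (a -
    1)(n - d) ([scaled_prod_content]). If v < na, a polynomial congruent to
    P(c + p^a X) modulo p^(na) has the same p-content v and the same reduction
    of Q, hence the same d; if v = na, both degrees must be n. This comparison
    is [congr_content_degree], and [count_residue_eq] is the resulting
    equality of counts. The bound on v is where the exponent na comes from. *)

(** * Newton's identities *)

Section Newton.

Variable R : comNzRingType.
Implicit Types s t : seq R.

(** The reciprocal of the polynomial with root sequence [s]: its constant
    coefficient is 1 and its k-th one is, up to sign, the k-th elementary
    symmetric function, so that Newton's identities read off directly. *)
Definition recip_prod s : {poly R} := \prod_(x <- s) (1 - x *: 'X).

Lemma recip_prod_cons x s : recip_prod (x :: s) = (1 - x *: 'X) * recip_prod s.
Proof. by rewrite /recip_prod big_cons. Qed.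

Lemma size_recip_prod s : (size (recip_prod s) <= (size s).+1)%N.
Proof.
elim: s => [|x s IHs]; first by rewrite /recip_prod big_nil size_poly1.
rewrite recip_prod_cons mulrBl mul1r (leq_trans (size_polyD _ _)) // size_polyN.
rewrite geq_max (leq_trans IHs) ?leqnSn //= -scalerAl.
rewrite (leq_trans (size_scale_leq _ _)) // mulrC.
by rewrite (leq_trans (size_polyMleq _ _)) // size_polyX addn2.
Qed.

Lemma coef0_recip_prod s : (recip_prod s)`_0 = 1.
Proof.
elim: s => [|x s IHs]; first by rewrite /recip_prod big_nil coef1.
rewrite recip_prod_cons mulrBl mul1r coefB -scalerAl coefZ coefXM.
by rewrite mulr0 subr0.
Qed.

Lemma geometric_poly N (x : R) :
  (1 - x *: 'X) * \poly_(j < N) x ^+ j.+1 = x%:P - x ^+ N.+1 *: 'X^N.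
Proof.
elim: N => [|N IHN].
  by rewrite poly_def big_ord0 mulr0 expr1 expr0 alg_polyC subrr.
rewrite poly_def big_ord_recr /= -(poly_def N (fun j => x ^+ j.+1)) mulrDr IHN.
by rewrite !exprS -!mul_polyC !polyCM; ring.
Qed.

(** The truncated form of the logarithmic derivative
    - R' / R = sum_(x <- s) x / (1 - x X), whose expansion is the generating
    series of the power sums.  The error term is kept as a multiple of X^N, to
    stay within polynomials. *)
Lemma deriv_recip_prod N s : exists W : {poly R},
  (recip_prod s)^`()
    = 'X^N * W - recip_prod s * \poly_(j < N) \sum_(x <- s) x ^+ j.+1.
Proof.
elim: s => [|x s [W IHs]].
  exists 0; rewrite /recip_prod big_nil mul1r mulr0 sub0r derivC.
  by apply/polyP=> k; rewrite coefN coef_poly big_nil if_same oppr0 coef0.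
exists ((1 - x *: 'X) * W - x ^+ N.+1 *: recip_prod s).
have -> : \poly_(j < N) \sum_(y <- x :: s) y ^+ j.+1
    = \poly_(j < N) x ^+ j.+1 + \poly_(j < N) \sum_(y <- s) y ^+ j.+1.
  apply/polyP=> k; rewrite coefD !coef_poly big_cons.
  by case: ifP => //; rewrite addr0.
rewrite recip_prod_cons derivM IHs derivB derivZ derivX derivC sub0r.
have := geometric_poly N x.
set T := \poly_(_ < _) _; set S := \poly_(_ < _) _ => eqT.
have -> : (1 - x *: 'X) * recip_prod s * (T + S)
    = recip_prod s * ((1 - x *: 'X) * T) + (1 - x *: 'X) * recip_prod s * S.
  by ring.
by rewrite eqT -!mul_polyC; ring.
Qed.

Lemma newton_recip_prod s k :
  (recip_prod s)`_k.+1 *+ k.+1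
    = - \sum_(j < k.+1) (recip_prod s)`_j * \sum_(x <- s) x ^+ (k - j).+1.
Proof.
have [W eqW] := deriv_recip_prod k.+1 s.
rewrite -coef_deriv eqW coefB coefXnM ltnSn sub0r coefM; congr (- _).
apply: eq_bigr => j _; congr (_ * _); rewrite coef_poly.
by have -> : (k - j < k.+1)%N by lia.
Qed.

(** Reversing the coefficients recovers the polynomial with root sequence [s].
    The sum runs to size s rather than to the actual size of the reciprocal,
    which drops when 0 is a root. *)
Lemma prod_XsubC_recip_prod s :
  \prod_(x <- s) ('X - x%:P)
    = \sum_(k < (size s).+1) (recip_prod s)`_k *: 'X^(size s - k).
Proof.
elim: s => [|x s IHs].
  by rewrite big_nil big_ord1 coef0_recip_prod expr0 scale1r.
have coef_cons k : (recip_prod (x :: s))`_k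
    = (recip_prod s)`_k - x * ('X * recip_prod s)`_k.
  by rewrite recip_prod_cons mulrBl mul1r -scalerAl coefB coefZ.
rewrite big_cons IHs /=; under [RHS]eq_bigr do rewrite coef_cons scalerBl.
rewrite sumrB mulrBl; congr (_ - _).
  rewrite [RHS]big_ord_recr /= [X in X *: _]nth_default ?size_recip_prod //.
  rewrite scale0r addr0 mulr_sumr; apply: eq_bigr => k _.
  by rewrite -scalerAr -exprS subSn // -ltnS.
rewrite [RHS]big_ord_recl /= [in RHS]coefXM mulr0 scale0r add0r mulr_sumr.
apply: eq_bigr => k _.
by rewrite coefXM /= subSS mul_polyC scalerA.
Qed.

End Newton.

(** Newton's identities determine the coefficients one after the other: the
    (k+1)-st is obtained from the earlier ones and the power sums after a
    division by k+1. *)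
Lemma eq_power_sums_prod_XsubC (R : comUnitRingType) (s t : seq R) :
    size s = size t ->
    (forall k, (0 < k <= size s)%N -> k%:R \is a @GRing.unit R) ->
    (forall k, (0 < k <= size s)%N ->
       \sum_(x <- s) x ^+ k = \sum_(x <- t) x ^+ k) ->
  \prod_(x <- s) ('X - x%:P) = \prod_(x <- t) ('X - x%:P).
Proof.
move=> eq_sz unit_k eq_sum; rewrite !prod_XsubC_recip_prod -eq_sz.
apply: eq_bigr => -[k ltk] _ /=; congr (_ *: _); move: ltk; rewrite ltnS.
elim/ltn_ind: k => -[|k] IHk lek; first by rewrite !coef0_recip_prod.
apply: (mulIr (unit_k k.+1 lek)).
rewrite !mulr_natr !newton_recip_prod; congr (- _).
apply: eq_bigr => -[j ltj] _ /=; rewrite IHk ?eq_sum //=.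
  by rewrite (leq_trans _ lek) // ltnS leq_subr.
exact: ltnW (leq_trans ltj lek).
Qed.

(** * Congruences between integer polynomials *)

Lemma PoszX m k : (m ^ k)%N%:Z = m%:Z ^+ k.
Proof. by rewrite -[LHS]natz natrX natz. Qed.

Lemma intr_Zp_eq0 m (z : int) : (1 < m)%N ->
  (z%:~R == 0 :> 'Z_m) = (m%:Z %| z)%Z.
Proof.
move=> m_gt1; rewrite dvdzE /=.
suff natE k : (k%:R == 0 :> 'Z_m) = (m %| k)%N.
  by case: z => k; rewrite ?NegzE ?rmorphN ?oppr_eq0 ?abszN /= -natE.
by rewrite -val_eqE /= val_Zp_nat.
Qed.

Lemma map_poly_Zp_eq m (A B : {poly int}) : (1 < m)%N ->
    map_poly (intr : int -> 'Z_m) A = map_poly intr B ->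
  exists D : {poly int}, A = B + m%:Z *: D.
Proof.
move=> m_gt1 eqAB.
exists (\poly_(i < size (A - B)) ((A - B)`_i %/ m%:Z)%Z).
apply/polyP=> i; rewrite coefD coefZ coef_poly.
have dvdi : (m%:Z %| (A - B)`_i)%Z.
  by rewrite -intr_Zp_eq0 // coefB rmorphB subr_eq0 /= -!coef_map eqAB.
case: ltnP => lti; first by rewrite mulrC divzK // coefB addrC subrK.
by rewrite mulr0 addr0; apply/eqP; rewrite -subr_eq0 -coefB nth_default.
Qed.

(** * Content and reduced degree after rescaling *)

Section Content.

Variables (p a : nat).
Hypothesis p_pr : prime p.

Let toFp : {poly int} -> {poly 'F_p} := map_poly intr.

Lemma intr_Fp_eq0 (z : int) : (z%:~R == 0 :> 'F_p) = (p%:Z %| z)%Z.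
Proof. by rewrite (dvdz_pcharf (pchar_Fp p_pr)). Qed.

(** The exponent w is min(v_p(z), a).  The bound says that it is less than a
    when p^a does not divide z. *)
Lemma scaled_linear_content (z : int) : exists w (Q : {poly int}),
  let d := (p%:Z ^+ a %| z)%Z in
  [/\ (p%:Z ^+ a) *: 'X - z%:P = p%:Z ^+ w *: Q,
      size (toFp Q) = d.+1 & (w.+1 <= a + d)%N].
Proof.
case: (boolP (_ %| z)%Z) => [/dvdzP[u ->]|ndvd].
  exists a, ('X - u%:P); split=> //; last by rewrite addn1.
    by rewrite scalerBr mulrC -mul_polyC polyCM -[in RHS]mul_polyC; ring.
  by rewrite /toFp rmorphB /= map_polyX map_polyC /= size_XsubC.
have z_neq0 : z != 0 by apply: contraNneq ndvd => ->; rewrite dvdz0.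
have dvdE k : (p%:Z ^+ k %| z)%Z = (k <= logn p `|z|)%N.
  by rewrite dvdzE abszX pfactor_dvdn // absz_gt0.
move: ndvd; rewrite dvdE -ltnNge; set w := logn p _ => ltwa.
have /dvdzP[u eq_z] : (p%:Z ^+ w %| z)%Z by rewrite dvdE.
have ndvd_u : ~~ (p%:Z %| u)%Z.
  apply: contraFN (ltnn w) => /dvdzP[u' eq_u].
  by rewrite -dvdE eq_z eq_u -mulrA -exprS dvdz_mull.
exists w, (p%:Z ^+ (a - w) *: 'X - u%:P); split; last by rewrite addn0.
  rewrite scalerBr scalerA -exprD subnKC ?(ltnW ltwa) // {1}eq_z.
  by rewrite mulrC polyCM mul_polyC.
rewrite /toFp rmorphB /= map_polyZ map_polyX map_polyC /= rmorphXn /=.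
have -> : p%:~R = 0 :> 'F_p by apply/eqP; rewrite intr_Fp_eq0.
rewrite expr0n subn_eq0 leqNgt ltwa scale0r sub0r size_polyN size_polyC.
by rewrite intr_Fp_eq0 ndvd_u.
Qed.

(** Gauss's lemma: contents multiply and reduced degrees add, because 'F_p[X]
    is a domain.  The inequality says that every root not divisible by p^a
    makes v fall short of a * size s by at least one. *)
Lemma scaled_prod_content (s : seq int) : exists v (Q : {poly int}),
  let d := count (fun z => (p%:Z ^+ a %| z)%Z) s in
  [/\ \prod_(z <- s) (p%:Z ^+ a *: 'X - z%:P) = p%:Z ^+ v *: Q,
      size (toFp Q) = d.+1 & (v + size s <= a * size s + d)%N].
Proof.
elim: s => [|z s [v [Q [eqQ szQ lev]]]].
  exists 0%N, 1; split; rewrite ?big_nil ?scale1r //.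
  by rewrite /toFp rmorph1 size_poly1.
have [w [Q1 [eqQ1 szQ1 lew]]] := scaled_linear_content z.
exists (w + v)%N, (Q1 * Q); split.
- by rewrite big_cons eqQ eqQ1 -scalerAl -scalerAr scalerA -exprD.
- rewrite /toFp rmorphM /= size_mul -/toFp -?size_poly_gt0 ?szQ ?szQ1 //=.
  by rewrite addnS.
by move: lev lew => /=; rewrite mulnS; lia.
Qed.

(** Congruent polynomials with content exponent below N have equal content and
    equal reduction modulo p.  If the smaller exponent is at least N, the two
    inequalities leave only d1 = d2 = n. *)
Lemma congr_content_degree N n v1 v2 d1 d2 (Q1 Q2 D : {poly int}) :
    p%:Z ^+ v1 *: Q1 = p%:Z ^+ v2 *: Q2 + p%:Z ^+ N *: D ->
    size (toFp Q1) = d1.+1 -> size (toFp Q2) = d2.+1 ->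
    (d1 <= n)%N -> (d2 <= n)%N ->
    (v1 + n <= N + d1)%N -> (v2 + n <= N + d2)%N ->
  d1 = d2.
Proof.
(* The two sides play symmetric roles, with D replaced by - D. *)
wlog le_v12 : v1 v2 d1 d2 Q1 Q2 D / (v1 <= v2)%N => [Hw|] eqQ s1 s2 l1 l2 b1 b2.
  case: (leqP v1 v2) => [|/ltnW] le_v; first exact: (Hw _ _ _ _ _ _ _ le_v eqQ).
  apply/esym; apply: (Hw _ _ _ _ Q2 Q1 (- D) le_v) => //.
  by rewrite eqQ scalerN addrK.
have [leNv1|ltv1N] := leqP N v1; first by lia.
have p_neq0 : (p%:Z ^+ v1)%:P != 0 :> {poly int}.
  by rewrite polyC_eq0 expf_neq0 // eqz_nat -lt0n prime_gt0.
(* Dividing by p^v1 leaves N - v1 > 0 factors p on the error term. *)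
have eqQ1 : Q1 = p%:Z ^+ (v2 - v1) *: Q2 + p%:Z ^+ (N - v1) *: D.
  apply: (mulfI p_neq0); rewrite !mul_polyC eqQ scalerDr !scalerA -!exprD.
  by rewrite !subnKC // ltnW.
have p0 k : (0 < k)%N -> (p%:Z ^+ k)%:~R = 0 :> 'F_p.
  move=> k_gt0; apply/eqP; rewrite intr_Fp_eq0 -(prednK k_gt0) exprS.
  by rewrite dvdz_mulr.
have eqF : toFp Q1 = (p%:Z ^+ (v2 - v1))%:~R *: toFp Q2.
  rewrite eqQ1 /toFp rmorphD /= !map_polyZ /= [X in _ + X *: _]p0 ?subn_gt0 //.
  by rewrite scale0r addr0.
(* If v1 < v2, then Q1 would vanish modulo p, against the size of its
   reduction. *)
have [eqv|] := posnP (v2 - v1).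
  by move: s1; rewrite eqF eqv expr0 scale1r s2 => -[].
by move/p0=> eq0; move: s1; rewrite eqF eq0 scale0r size_poly0.
Qed.

End Content.

(** * Residue classes of the roots *)

(** The substitution of c + p^a X turns the roots congruent to c modulo p^a
    into multiples of p^a, which [scaled_prod_content] counts by the degree
    modulo p; the modulus p^(a * size s) is large enough to compare degrees. *)
Lemma count_residue_eq (p a : nat) (s t : seq int) (c : int) :
    prime p -> (0 < a)%N -> (0 < size s)%N -> size s = size t ->
    map_poly (intr : int -> 'Z_(p ^ (a * size s))) (\prod_(z <- s) ('X - z%:P))
      = map_poly intr (\prod_(z <- t) ('X - z%:P)) ->
  count (fun z => (p%:Z ^+ a %| z - c)%Z) s
    = count (fun z => (p%:Z ^+ a %| z - c)%Z) t.
Proof.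
move=> p_pr a_gt0 s_gt0 eq_sz.
have M_gt1 : (1 < p ^ (a * size s))%N.
  by rewrite -(exp1n (a * size s)) ltn_exp2r ?prime_gt1 // muln_gt0 a_gt0.
move=> /(map_poly_Zp_eq M_gt1)[D eqD].
pose L : {poly int} := p%:Z ^+ a *: 'X + c%:P.
have subst u : \prod_(z <- u) ('X - z%:P) \Po L
    = \prod_(z <- [seq z - c | z <- u]) (p%:Z ^+ a *: 'X - z%:P).
  rewrite rmorph_prod big_map; apply: eq_bigr => z _.
  by rewrite /= comp_polyB comp_polyX comp_polyC polyCB /L; ring.
have := congr1 (comp_poly L) eqD.
rewrite comp_polyD comp_polyZ !subst.
have [v1 [Q1 [-> sz1 le1]]] := scaled_prod_content a p_pr [seq z - c | z <- s].
have [v2 [Q2 [-> sz2 le2]]] := scaled_prod_content a p_pr [seq z - c | z <- t].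
rewrite PoszX => eqQ.
move: sz1 sz2 le1 le2; rewrite !size_map !count_map -eq_sz => sz1 sz2 le1 le2.
apply: (congr_content_degree p_pr eqQ sz1 sz2 _ _ le1 le2).
  exact: count_size.
by rewrite eq_sz count_size.
Qed.

(** The indices k <= size s < p are units modulo any power of p, so Newton's
    identities can be solved over Z/p^N. *)
Lemma power_sums_congr_prod_XsubC (p N : nat) (s t : seq int) :
    prime p -> (0 < N)%N -> (size s < p)%N -> size s = size t ->
    (forall k, (0 < k <= size s)%N ->
       (\sum_(z <- s) z ^+ k = \sum_(z <- t) z ^+ k %[mod p%:Z ^+ N])%Z) ->
  map_poly (intr : int -> 'Z_(p ^ N)) (\prod_(z <- s) ('X - z%:P))
    = map_poly intr (\prod_(z <- t) ('X - z%:P)).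
Proof.
move=> p_pr N_gt0 lt_sp eq_sz eq_sum.
have M_gt1 : (1 < p ^ N)%N by rewrite -(exp1n N) ltn_exp2r ?prime_gt1.
have map_prod u :
    map_poly (intr : int -> 'Z_(p ^ N)) (\prod_(z <- u) ('X - z%:P))
      = \prod_(z <- [seq z%:~R | z <- u]) ('X - z%:P).
  rewrite rmorph_prod big_map; apply: eq_bigr => z _.
  by rewrite rmorphB /= map_polyX map_polyC.
rewrite !map_prod; apply: eq_power_sums_prod_XsubC; rewrite !size_map //.
  move=> k /andP[k_gt0 lek]; rewrite unitZpE // coprimeXl // prime_coprime //.
  apply: contraL (leq_ltn_trans lek lt_sp) => /(dvdn_leq k_gt0).
  by rewrite -leqNgt.
move=> k /eq_sum/eqP; rewrite eqz_mod_dvd !big_map => dvdS.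
apply/eqP; rewrite -subr_eq0; move: dvdS; rewrite -PoszX -intr_Zp_eq0 //.
rewrite rmorphB !rmorph_sum /=.
by congr (_ - _ == 0); apply: eq_bigr => z _; rewrite rmorphXn.
Qed.

Theorem corollary1p3 (n a p : nat) (hp : prime p) (hpn : (n < p)%N)
    (hn : (2 <= n)%N) (x y : 'I_n -> int)
    (hxy : forall j : nat, (1 <= j <= n)%N ->
       ((\sum_(i < n) x i ^+ j)%R = (\sum_(i < n) y i ^+ j)%R
          %[mod (p%:Z ^+ (n * a))%R])%Z) :
  exists sigma : 'S_n, forall j : 'I_n,
    (x j = y (sigma j) %[mod (p%:Z ^+ a)%R])%Z.
Proof.
have [->|a_gt0] := posnP a.
  by exists 1%g => j; rewrite expr0 !modz1.
pose s := [seq x i | i : 'I_n]; pose t := [seq y i | i : 'I_n].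
have sz_s : size s = n by rewrite size_image card_ord.
have sz_t : size t = n by rewrite size_image card_ord.
have eq_prod : map_poly (intr : int -> 'Z_(p ^ (a * size s)))
    (\prod_(z <- s) ('X - z%:P)) = map_poly intr (\prod_(z <- t) ('X - z%:P)).
  apply: power_sums_congr_prod_XsubC; rewrite ?sz_s ?sz_t //.
    by rewrite muln_gt0 a_gt0 ltnW.
  by move=> k /hxy; rewrite mulnC !big_image.
pose residues (z : 'I_n -> int) := [tuple (z i %% p%:Z ^+ a)%Z | i < n].
have /tuple_permP[sigma eq_xy] : perm_eq (residues x) (residues y).
  apply/allP => r; rewrite mem_cat => r_residue.
  (* Only canonical residues occur, so r itself represents its class. *)
  have r_mod : (r %% p%:Z ^+ a)%Z = r.
    by case/orP: r_residue => /mapP[i _ ->]; rewrite modz_mod.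
  have count_residues (z : 'I_n -> int) : count_mem r (residues z)
      = count (fun u => (p%:Z ^+ a %| u - r)%Z) [seq z i | i : 'I_n].
    rewrite !count_map; apply: eq_count => i /=.
    by rewrite -eqz_mod_dvd r_mod.
  rewrite /= !count_residues (count_residue_eq _ _ _ _ _ eq_prod) //.
    by rewrite sz_s ltnW.
  by rewrite sz_s sz_t.
exists sigma => j.
have /(congr1 (fun u : n.-tuple int => tnth u j)) := val_inj eq_xy.
by rewrite !tnth_mktuple.
Qed.
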